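(* Consider the conditionally Gaussian model of the context (with $\psi$ bounded), suppose the contraction assumption of the context holds for some $r_c>0$, and let $r=\sigma/\gamma\in[0,r_c)$. Let $N\ge1$ and let $\{v_k^{(n)}\}_{n=1}^N$ be the particles of the Gaussianized optimal particle filter with data $\{y^\dagger_k\}$. Then there is a constant $c$, independent of $\gamma$, such that $$\limsup_{k\to\infty}\ \mathbb{E}\Bigl(\max_{1\le n\le N}\bigl\|v_k^{(n)}-u_k^\dagger\bigr\|^2\Bigr)\ \le\ c\,\gamma^2,$$ where $\mathbb{E}$ is expectation with respect to the noise generating the data and the randomness within the particle filter.
   Context: $\mathcal{X}$ and $\mathcal{Y}$ are finite-dimensional Euclidean spaces. For symmetric positive definite $A$, $|\cdot|_A=|A^{-1/2}\cdot|$. Model. $\psi:\mathcal{X}\to\mathcal{X}$ is bounded (and measurable), $H:\mathcal{X}\to\mathcal{Y}$ is linear, and $$u_{k+1}=\psi(u_k)+\xi_k,\qquad y_{k+1}=Hu_{k+1}+\eta_{k+1},$$ with $u_0\sim\mu_0$ (a probability measure on $\mathcal{X}$), $\xi_k\sim N(0,\Sigma)$ i.i.d., $\eta_k\sim N(0,\Gamma)$ i.i.d., and $u_0,\{\xi_k\},\{\eta_k\}$ independent. Here $\Sigma=\sigma^2\Sigma_0$, $\Gamma=\gamma^2\Gamma_0$ with $\Sigma_0,\Gamma_0$ strictly positive definite and fixed, $\sigma,\gamma\in(0,\infty)$, $r:=\sigma/\gamma\in(0,\infty)$. Set $$C^{-1}=\Sigma^{-1}+H^*\Gamma^{-1}H,\quad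 S=H\Sigma H^*+\Gamma,\quad K=\Sigma H^*S^{-1}=r^2\Sigma_0H^*(r^2H\Sigma_0H^*+\Gamma_0)^{-1}.$$ Contraction assumption (with $r_c>0$). $\|\cdot\|$ is a norm on $\mathcal{X}$ and, for all $r\in[0,r_c)$, the function $(I-KH)\psi(\cdot)$ is globally Lipschitz on $\mathcal{X}$ with respect to $\|\cdot\|$ with Lipschitz constant $\alpha=\alpha(r)<1$. Fixed data. Fix $u_0^\dagger\in\mathcal{X}$ and positive semi-definite matrices $\Sigma_*,\Gamma_*$ on $\mathcal{X},\mathcal{Y}$, and let $$u^\dagger_{k+1}=\psi(u^\dagger_k)+r\gamma\,\xi^\dagger_k,\qquad y^\dagger_{k+1}=Hu^\dagger_{k+1}+\gamma\,\eta^\dagger_{k+1},$$ with $\xi^\dagger_k\sim N(0,\Sigma_* )$ i.i.d., $\eta^\dagger_k\sim N(0,\Gamma_* )$ i.i.d., the two sequences being independent. One considers the family parameterized by $\gamma$, with $r$ and the noise sequences $\xi^\dagger,\eta^\dagger$ fixed. Gaussianized optimal particle filter (GOPF). Initialize $v_0^{(n)}\sim\mu_0$ i.i.d., $n=1,\dots,N$. Given data $\{y_k\}$ (here $y_k=y_k^\dagger$), $$\widetilde v_{k}^{(n)}=\sum_{m=1}^N \mathbb{I}_{I_{k+1}^{(m)}}(r_{k+1}^{(n)})\,v_{k}^{(m)},\quad r_{k+1}^{(n)}\sim U(0,1)\ \text{i.i.d.},$$ $$v_{k+1}^{(n)}=(I-KH)\psi(\widetilde v_k^{(n)})+Ky_{k+1}+\zeta_k^{(n)},\quad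 \zeta_k^{(n)}\sim N(0,C)\ \text{i.i.d.},$$ with weights $$w_{k+1}^{(n),*}=\exp\bigl(-\tfrac12|y_{k+1}-H\psi(v_k^{(n)})|_S^2\bigr),\quad w_{k+1}^{(n)}=\frac{w_{k+1}^{(n),*}}{\sum_{m=1}^Nw_{k+1}^{(m),*}},$$ and intervals $I_{k+1}^{(m)}=[\alpha_{k+1}^{(m-1)},\alpha_{k+1}^{(m)})$, $\alpha_{k+1}^{(0)}=0$, $\alpha_{k+1}^{(m)}=\alpha_{k+1}^{(m-1)}+w_{k+1}^{(m)}$, $m=1,\dots,N$. The initial particles, $\zeta_k^{(n)}$ and $r_k^{(n)}$ are independent of each other and of the data. *)

(* Defs.v *)
From HB Require Import structures.
From mathcomp Require Import all_boot all_order all_algebra.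
From mathcomp Require Import all_classical all_reals all_analysis.

Set Implicit Arguments.
Unset Strict Implicit.
Unset Printing Implicit Defensive.

Import Order.TTheory GRing.Theory Num.Theory.
Import numFieldNormedType.Exports.

Local Open Scope classical_set_scope.
Local Open Scope ring_scope.

Definition dotv (R : realType) n (x y : 'cV[R]_n) : R := (x^T *m y) 0 0.

Definition enorm (R : realType) n (x : 'cV[R]_n) : R := Num.sqrt (dotv x x).

Definition posdefmx (R : realType) n (A : 'M[R]_n) : Prop :=
  A^T = A /\ forall x : 'cV[R]_n, x != 0 -> 0 < dotv x (A *m x).

Definition possemidefmx (R : realType) n (A : 'M[R]_n) : Prop :=
  A^T = A /\ forall x : 'cV[R]_n, 0 <= dotv x (A *m x).

(* A^{-1/2} for a symmetric positive definite A, i.e. the unique symmetric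
   positive definite square root of A^{-1}; the default value 0 is only
   reached when A is not positive definite. *)
Definition invsqrtmx (R : realType) n (A : 'M[R]_n) : 'M[R]_n :=
  xget 0 [set B : 'M[R]_n | posdefmx B /\ B *m B = invmx A].

Definition weighted_norm (R : realType) n (A : 'M[R]_n) (x : 'cV[R]_n) : R :=
  enorm (invsqrtmx A *m x).

Definition is_norm (R : realType) n (nrm : 'cV[R]_n -> R) : Prop :=
  [/\ forall x y, nrm (x + y) <= nrm x + nrm y,
      forall (a : R) x, nrm (a *: x) = `|a| * nrm x &
      forall x, nrm x = 0 -> x = 0].

Definition borelcV (R : realType) (n : nat) :=
  g_sigma_algebraType (@open 'cV[R]_n).

Definition has_law (R : realType) d (Omega : measurableType d)
    (P : probability Omega R) d' (E : measurableType d')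
    (X : Omega -> E) (mu : set E -> \bar R) : Prop :=
  measurable_fun setT X /\
  forall B : set E, measurable B -> P (X @^-1` B) = mu B.

(* The centered normal law on R with VARIANCE v >= 0. The null variance has to
   be treated separately, as normal_prob 0 0 is not the Dirac mass at 0. *)
Definition normal1 (R : realType) (v : R) (A : set R) : \bar R :=
  if v == 0 then \d_(0 : R) A else normal_prob 0 (Num.sqrt v) A.

(* X ~ N(0, S), for S symmetric positive semi-definite, possibly singular:
   every linear functional <a, X> is normal with variance <a, S a>. *)
Definition gaussian (R : realType) d (Omega : measurableType d)
    (P : probability Omega R) n (S : 'M[R]_n) (X : Omega -> 'cV[R]_n) : Prop :=
  measurable_fun setT (X : Omega -> borelcV R n) /\
  forall a : 'cV[R]_n,
    has_law P (fun w => dotv a (X w)) (normal1 (dotv a (S *m a))).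

Definition mutually_independent (R : realType) d (Omega : measurableType d)
    (P : probability Omega R) (I : Type) (G : I -> set (set Omega)) : Prop :=
  forall (m : nat) (t : 'I_m -> I), injective t ->
  forall A : 'I_m -> set Omega, (forall j, G (t j) (A j)) ->
    P (\bigcap_j A j) = (\prod_(j < m) P (A j))%E.

Definition innov_cov (R : realType) dX dY (H : 'M[R]_(dY, dX))
    (Sigma : 'M[R]_dX) (Gamma : 'M[R]_dY) : 'M[R]_dY :=
  H *m Sigma *m H^T + Gamma.

Definition gain (R : realType) dX dY (H : 'M[R]_(dY, dX))
    (Sigma : 'M[R]_dX) (Gamma : 'M[R]_dY) : 'M[R]_(dX, dY) :=
  Sigma *m H^T *m invmx (innov_cov H Sigma Gamma).

Definition post_cov (R : realType) dX dY (H : 'M[R]_(dY, dX))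
    (Sigma : 'M[R]_dX) (Gamma : 'M[R]_dY) : 'M[R]_dX :=
  invmx (invmx Sigma + H^T *m invmx Gamma *m H).

(* K = gain (sigma^2 Sigma0) (gamma^2 Gamma0) depends on r = sigma / gamma
   only: it is gain (r^2 Sigma0) Gamma0, which still makes sense at r = 0. *)
Definition contraction_assumption (R : realType) dX dY (psi : 'cV[R]_dX -> 'cV[R]_dX)
    (H : 'M[R]_(dY, dX)) (Sigma0 : 'M[R]_dX) (Gamma0 : 'M[R]_dY)
    (nrm : 'cV[R]_dX -> R) (r_c : R) : Prop :=
  forall r : R, 0 <= r < r_c ->
  exists2 alpha : R, 0 <= alpha < 1 &
  forall x y : 'cV[R]_dX,
    let F z := (1%:M - gain H (r ^+ 2 *: Sigma0) Gamma0 *m H) *m psi z in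
    nrm (F x - F y) <= alpha * nrm (x - y).

(* Pathwise, for given noise realizations xi and eta. The observation at time 0
   and eta 0 are never used. *)

Fixpoint truth (R : realType) dX (psi : 'cV[R]_dX -> 'cV[R]_dX) (s : R)
    (u0 : 'cV[R]_dX) (xi : nat -> 'cV[R]_dX) (k : nat) : 'cV[R]_dX :=
  if k is k'.+1 then psi (truth psi s u0 xi k') + s *: xi k' else u0.

Definition observations (R : realType) dX dY (H : 'M[R]_(dY, dX)) (gamma : R)
    (u : nat -> 'cV[R]_dX) (eta : nat -> 'cV[R]_dY) (k : nat) : 'cV[R]_dY :=
  H *m u k + gamma *: eta k.

(* Particles are indexed from 0, so that the m-th resampling interval is [cumul w m, cumul w m.+1[. *)

Definition unnorm_weight (R : realType) dX dY (psi : 'cV[R]_dX -> 'cV[R]_dX)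
    (H : 'M[R]_(dY, dX)) (Sigma : 'M[R]_dX) (Gamma : 'M[R]_dY) N
    (v : 'I_N -> 'cV[R]_dX) (y : 'cV[R]_dY) (n : 'I_N) : R :=
  expR (- (2^-1 *
    weighted_norm (innov_cov H Sigma Gamma) (y - H *m psi (v n)) ^+ 2)).

Definition weight (R : realType) dX dY (psi : 'cV[R]_dX -> 'cV[R]_dX)
    (H : 'M[R]_(dY, dX)) (Sigma : 'M[R]_dX) (Gamma : 'M[R]_dY) N
    (v : 'I_N -> 'cV[R]_dX) (y : 'cV[R]_dY) (n : 'I_N) : R :=
  unnorm_weight psi H Sigma Gamma v y n
  / \sum_(m < N) unnorm_weight psi H Sigma Gamma v y m.

Definition cumul (R : realType) N (w : 'I_N -> R) (m : nat) : R :=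
  \sum_(j < N | (j < m)%N) w j.

Definition resample (R : realType) dX N (w : 'I_N -> R)
    (v : 'I_N -> 'cV[R]_dX) (t : R) : 'cV[R]_dX :=
  \sum_(m < N) \1_(`[cumul w m, cumul w m.+1[ : set R) t *: v m.

Fixpoint gopf (R : realType) dX dY (psi : 'cV[R]_dX -> 'cV[R]_dX)
    (H : 'M[R]_(dY, dX)) (Sigma : 'M[R]_dX) (Gamma : 'M[R]_dY) N
    (y : nat -> 'cV[R]_dY) (v0 : 'I_N -> 'cV[R]_dX)
    (rho : nat -> 'I_N -> R) (zeta : nat -> 'I_N -> 'cV[R]_dX)
    (k : nat) : 'I_N -> 'cV[R]_dX :=
  if k is k'.+1 then
    let v := gopf psi H Sigma Gamma y v0 rho zeta k' in
    let K := gain H Sigma Gamma in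
    let w := weight psi H Sigma Gamma v (y k) in
    fun n => (1%:M - K *m H) *m psi (resample w v (rho k n))
             + K *m y k + zeta k' n
  else v0.

(* In this order: xi_k, eta_{k+1}, v_0^(n), r_{k+1}^(n) and zeta_k^(n). *)

Inductive source (N : nat) : Type :=
| TruthNoise of nat
| DataNoise of nat
| InitParticle of 'I_N
| Resampling of nat & 'I_N
| Mutation of nat & 'I_N.

Definition source_algebra (R : realType) d (Omega : measurableType d) dX dY N
    (xi : nat -> Omega -> 'cV[R]_dX) (eta : nat -> Omega -> 'cV[R]_dY)
    (v0 : 'I_N -> Omega -> 'cV[R]_dX) (rho : nat -> 'I_N -> Omega -> R)
    (zeta : nat -> 'I_N -> Omega -> 'cV[R]_dX)
    (s : source N) : set (set Omega) :=
  match s with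
  | TruthNoise k => g_sigma_algebra_preimage (xi k : Omega -> borelcV R dX)
  | DataNoise k => g_sigma_algebra_preimage (eta k.+1 : Omega -> borelcV R dY)
  | InitParticle n => g_sigma_algebra_preimage (v0 n : Omega -> borelcV R dX)
  | Resampling k n => g_sigma_algebra_preimage (rho k.+1 n)
  | Mutation k n => g_sigma_algebra_preimage (zeta k n : Omega -> borelcV R dX)
  end.

Definition data_algebra (R : realType) d (Omega : measurableType d) dX dY
    (xi : nat -> Omega -> 'cV[R]_dX) (eta : nat -> Omega -> 'cV[R]_dY)
    (s : nat + nat) : set (set Omega) :=
  match s with
  | inl k => g_sigma_algebra_preimage (xi k : Omega -> borelcV R dX)
  | inr k => g_sigma_algebra_preimage (eta k.+1 : Omega -> borelcV R dY)
  end.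

Definition data_noise (R : realType) d (Omega : measurableType d)
    (P : probability Omega R) dX dY (Sigmas : 'M[R]_dX) (Gammas : 'M[R]_dY)
    (xi : nat -> Omega -> 'cV[R]_dX) (eta : nat -> Omega -> 'cV[R]_dY) : Prop :=
  [/\ forall k, gaussian P Sigmas (xi k),
      forall k, gaussian P Gammas (eta k.+1) &
      mutually_independent P (data_algebra xi eta)].

Definition filter_noise (R : realType) d (Omega : measurableType d)
    (P : probability Omega R) dX dY N (mu0 : probability (borelcV R dX) R)
    (C : 'M[R]_dX)
    (xi : nat -> Omega -> 'cV[R]_dX) (eta : nat -> Omega -> 'cV[R]_dY)
    (v0 : 'I_N -> Omega -> 'cV[R]_dX) (rho : nat -> 'I_N -> Omega -> R)
    (zeta : nat -> 'I_N -> Omega -> 'cV[R]_dX) : Prop :=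
  [/\ forall n, has_law P (v0 n : Omega -> borelcV R dX) mu0,
      forall k n, has_law P (rho k.+1 n) (uniform_prob (@ltr01 R)),
      forall k n, gaussian P C (zeta k n) &
      mutually_independent P (source_algebra xi eta v0 rho zeta)].

(* Main.v *)
Require Import Defs.
From HB Require Import structures.
From mathcomp Require Import all_boot all_order all_algebra.
From mathcomp Require Import all_classical all_reals all_analysis.
From mathcomp Require Import measurable_realfun ring lra.

Set Implicit Arguments.
Unset Strict Implicit.
Unset Printing Implicit Defensive.

Import Order.TTheory GRing.Theory Num.Theory.
Import numFieldNormedType.Exports.

Local Open Scope classical_set_scope.
Local Open Scope ring_scope.

(** Write [A = I - K H]. Because [y_(k+1) = H u_(k+1) + gamma eta_(k+1)] and
[u_(k+1) = psi (u_k) + r gamma xi_k], subtracting the truth from the particle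
update gives the error equation
[[
v_(k+1)^n - u_(k+1) = (A psi (vt_k^n) - A psi (u_k)) + e_k^n,
e_k^n = - r gamma A xi_k + gamma K eta_(k+1) + zeta_k^n,
]]
where the resampled particle [vt_k^n] is one of the [v_k^m] as soon as the
uniform variable is at least 0 and less than 1 (lemma [resample_mem]), which
happens almost surely. The contraction assumption and the convexity inequality
[(alpha a + b)^2 <= alpha a^2 + b^2 / (1 - alpha)] then give, for
[M_k = max_n (nrm (v_k^n - u_k))^2],
[[
M_(k+1) <= alpha M_k + V_k / (1 - alpha)
]]
with [V_k] a nonnegative quadratic form in the noises that dominates every
[(nrm e_k^n)^2]. The contraction holds with one [alpha] for all [gamma] because
the gain depends on [r] only ([gainZ]), and the expectation of [V_k] is at most
[D gamma^2] because the covariance of [zeta] is [gamma^2] times a matrix that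
depends on [r] only ([post_covZ]). Iterating, the limsup is at most
[D gamma^2 / (1 - alpha)^2].

The initial law may have no second moment, so that the expectation of [M_0] may
be infinite. As [psi] is bounded, [M_1] is nevertheless bounded by a constant
plus [2 V_0], and the recursion is started there.

Every bound is taken pathwise before expectations, so no independence enters,
and of the Gaussian laws only a bound of the second moment by a multiple of the
variance is used. Bounding [M_(k+1)] by an explicit measurable majorant
([error_majorant]) also makes the measurability of the particles irrelevant. *)

(** * Quadratic forms and positive definite matrices *)

Lemma dotvE (R : realType) n (x y : 'cV[R]_n) :
  dotv x y = \sum_i x i 0 * y i 0.
Proof. by rewrite /dotv mxE; apply: eq_bigr => i _; rewrite mxE. Qed.

Lemma dotvDr (R : realType) n (x y z : 'cV[R]_n) :
  dotv x (y + z) = dotv x y + dotv x z.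
Proof. by rewrite /dotv mulmxDr mxE. Qed.

Lemma dotvZr (R : realType) n (a : R) (x y : 'cV[R]_n) :
  dotv x (a *: y) = a * dotv x y.
Proof. by rewrite /dotv -scalemxAr mxE. Qed.

Lemma dotv_adj (R : realType) m n (A : 'M[R]_(m, n)) (x : 'cV[R]_n)
  (y : 'cV[R]_m) : dotv (A *m x) y = dotv x (A^T *m y).
Proof. by rewrite /dotv trmx_mul mulmxA. Qed.

Lemma dotv_ge0 (R : realType) n (x : 'cV[R]_n) : 0 <= dotv x x.
Proof. by rewrite dotvE sumr_ge0// => i _; rewrite -expr2 sqr_ge0. Qed.

Lemma dotv_delta_mx (R : realType) n (i : 'I_n) (x : 'cV[R]_n) :
  dotv (delta_mx i 0) x = x i 0.
Proof.
rewrite dotvE (bigD1 i)//= big1 ?addr0; last first.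
  by move=> j /negbTE ji; rewrite mxE ji mul0r.
by rewrite mxE !eqxx mul1r.
Qed.

Lemma normr_le_enorm (R : realType) n (x : 'cV[R]_n) i : `|x i 0| <= enorm x.
Proof.
rewrite -sqrtr_sqr ler_wsqrtr// dotvE (bigD1 i)//= expr2 lerDl.
by rewrite sumr_ge0// => j _; rewrite -expr2 sqr_ge0.
Qed.

Lemma posdefmx_ge0 (R : realType) n (A : 'M[R]_n) (x : 'cV[R]_n) :
  posdefmx A -> 0 <= dotv x (A *m x).
Proof.
move=> [_ Apos]; have [->|/Apos/ltW//] := eqVneq x 0.
by rewrite mulmx0 dotv_ge0.
Qed.

Lemma posdefmx_possemidefmx (R : realType) n (A : 'M[R]_n) :
  posdefmx A -> possemidefmx A.
Proof. by move=> A_pos; split; [case: A_pos|move=> x; exact: posdefmx_ge0]. Qed.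

Lemma possemidefmx_diag_ge0 (R : realType) n (A : 'M[R]_n) i :
  possemidefmx A -> 0 <= A i i.
Proof.
by move=> [_ /(_ (delta_mx i 0))]; rewrite dotv_delta_mx -colE mxE.
Qed.

Lemma posdefmx_unitmx (R : realType) n (A : 'M[R]_n) :
  posdefmx A -> A \in unitmx.
Proof.
move=> [A_sym A_pos]; rewrite unitmxE unitfE; apply/det0P => -[v v0 vA0].
have /A_pos : v^T != 0 by rewrite trmx_eq0.
by rewrite -[A *m _]trmxK trmx_mul trmxK A_sym vA0 trmx0 /dotv mulmx0 mxE ltxx.
Qed.

Lemma posdefmxZ (R : realType) n (a : R) (A : 'M[R]_n) :
  0 < a -> posdefmx A -> posdefmx (a *: A).
Proof.
move=> a0 [A_sym A_pos]; split; first by rewrite linearZ/= A_sym.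
by move=> x x0; rewrite -scalemxAl dotvZr mulr_gt0// A_pos.
Qed.

Lemma posdefmx_inv (R : realType) n (A : 'M[R]_n) :
  posdefmx A -> posdefmx (invmx A).
Proof.
move=> A_pos; have A_unit := posdefmx_unitmx A_pos.
case: (A_pos) => A_sym A_gt0; split; first by rewrite trmx_inv A_sym.
move=> x x0; rewrite -{1}(mulKVmx A_unit x) dotv_adj A_sym.
apply: A_gt0; apply: contra_neq x0 => Ax0.
by rewrite -(mulKVmx A_unit x) Ax0 mulmx0.
Qed.

Lemma posdefmxD_congr (R : realType) m n (A : 'M[R]_n) (B : 'M[R]_m)
    (T : 'M[R]_(m, n)) :
  posdefmx A -> posdefmx B -> posdefmx (A + T^T *m B *m T).
Proof.
move=> [A_sym A_pos] B_pos; split.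
  by rewrite linearD/= A_sym !trmx_mul trmxK B_pos.1 mulmxA.
move=> x x0; rewrite mulmxDl dotvDr ltr_wpDr ?A_pos// -!mulmxA -dotv_adj.
exact: posdefmx_ge0.
Qed.

(** * Scaling of the gain and of the posterior covariance *)

Section covariances.
Context (R : realType) (dX dY : nat).
Variables (H : 'M[R]_(dY, dX)) (Sigma : 'M[R]_dX) (Gamma : 'M[R]_dY).
Hypotheses (Sigma_pos : posdefmx Sigma) (Gamma_pos : posdefmx Gamma).

Lemma posdefmx_innov_cov : posdefmx (innov_cov H Sigma Gamma).
Proof.
by rewrite /innov_cov addrC -{1}[H]trmxK; apply: posdefmxD_congr.
Qed.

Lemma posdefmx_post_cov : posdefmx (post_cov H Sigma Gamma).
Proof.
by apply: posdefmx_inv; apply: posdefmxD_congr; exact: posdefmx_inv.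
Qed.

Variables (g : R) (g_gt0 : 0 < g).

Lemma innov_covZ :
  innov_cov H (g *: Sigma) (g *: Gamma) = g *: innov_cov H Sigma Gamma.
Proof. by rewrite /innov_cov scalerDr -scalemxAr -scalemxAl. Qed.

Lemma gainZ : gain H (g *: Sigma) (g *: Gamma) = gain H Sigma Gamma.
Proof.
rewrite /gain innov_covZ invmxZ; last first.
  by apply/posdefmx_unitmx/posdefmxZ/posdefmx_innov_cov.
by rewrite -!scalemxAl -scalemxAr scalerA divff ?scale1r// gt_eqF.
Qed.

Lemma post_covZ :
  post_cov H (g *: Sigma) (g *: Gamma) = g *: post_cov H Sigma Gamma.
Proof.
rewrite /post_cov !invmxZ; try exact/posdefmx_unitmx/posdefmxZ.
rewrite -scalemxAr -scalemxAl -scalerDr invmxZ ?invrK//.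
apply/posdefmx_unitmx/posdefmxZ; first by rewrite invr_gt0.
by apply: posdefmxD_congr; exact: posdefmx_inv.
Qed.

End covariances.

(** * Seminorms and the Euclidean norm *)

Section seminorms.
Context (R : realType) (n : nat).
Variable p : 'cV[R]_n -> R.
Hypothesis pD : forall x y, p (x + y) <= p x + p y.
Hypothesis pZ : forall (a : R) x, p (a *: x) = `|a| * p x.

Lemma seminorm0 : p 0 = 0.
Proof. by rewrite -(scale0r 0) pZ normr0 mul0r. Qed.

Lemma seminormN x : p (- x) = p x.
Proof. by rewrite -scaleN1r pZ normrN1 mul1r. Qed.

Lemma seminorm_ge0 x : 0 <= p x.
Proof.
by have := pD x (- x); rewrite subrr seminorm0 seminormN -mulr2n pmulrn_lge0.
Qed.

Lemma seminorm_le_enorm x : p x <= (\sum_i p (delta_mx i 0)) * enorm x.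
Proof.
rewrite [in leLHS](matrix_sum_delta x) mulr_suml.
elim/big_ind2 : _ => [|a1 b1 a2 b2 ab1 ab2|i _]; first by rewrite seminorm0.
  by rewrite (le_trans (pD _ _))// lerD.
rewrite big_ord1 pZ mulrC ler_wpM2l ?seminorm_ge0//.
exact: normr_le_enorm.
Qed.

Lemma seminorm_sqr_le_dotv :
  exists2 kappa : R, 0 <= kappa & forall x, p x ^+ 2 <= kappa * dotv x x.
Proof.
exists ((\sum_i p (delta_mx i 0)) ^+ 2); first exact: sqr_ge0.
move=> x; rewrite -[dotv x x]sqr_sqrtr ?dotv_ge0// -exprMn.
rewrite ler_sqr ?seminorm_le_enorm// nnegrE ?seminorm_ge0//.
by rewrite mulr_ge0 ?sqrtr_ge0// sumr_ge0// => i _; rewrite seminorm_ge0.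
Qed.

End seminorms.

Lemma seminorm_mulmx_sqr_le_dotv (R : realType) m n (p : 'cV[R]_m -> R)
    (A : 'M[R]_(m, n)) : is_norm p ->
  exists2 kappa : R, 0 <= kappa & forall x, p (A *m x) ^+ 2 <= kappa * dotv x x.
Proof.
move=> [pD pZ _]; apply: (@seminorm_sqr_le_dotv _ _ (fun x => p (A *m x))).
  by move=> x y; rewrite mulmxDr.
by move=> a x; rewrite -scalemxAr.
Qed.

(** * Resampling *)

(** The resampling intervals partition the half-open unit interval, so exactly
    one indicator in the definition of [resample] is nonzero. *)
Lemma resample_mem (R : realType) dX N (w : 'I_N -> R)
    (v : 'I_N -> 'cV[R]_dX) (t : R) :
  (forall n, 0 <= w n) -> \sum_n w n = 1 -> 0 <= t < 1 ->
  exists m, resample w v t = v m.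
Proof.
move=> w_ge0 w_sum1 /andP[t0 t1].
have cumul_le i j : (i <= j)%N -> cumul w i <= cumul w j.
  move=> ij; rewrite /cumul [leRHS]big_mkcond [leLHS]big_mkcond/=.
  apply: ler_sum => n _; case: ifPn => [ni|_]; last by case: ifP.
  by rewrite (leq_trans ni ij).
have cumul0 : cumul w 0 = 0 by rewrite /cumul big_pred0.
have cumulN j : (N <= j)%N -> cumul w j = 1.
  move=> Nj; rewrite /cumul -w_sum1; apply: eq_bigl => n.
  by rewrite (leq_trans (ltn_ord n) Nj).
have exP : exists m, cumul w m <= t by exists 0%N; rewrite cumul0.
have ltN m : cumul w m <= t -> (m < N)%N.
  move=> wmt; rewrite ltnNge; apply/negP => /cumulN wm.
  by move: wmt; rewrite wm leNgt t1.
have bound m : cumul w m <= t -> (m <= N)%N by move/ltN/ltnW.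
(* The selected index is the last one whose cumulated weight is at most t. *)
case: (ex_maxnP exP bound) => m wmt m_max.
have mN := ltN _ wmt.
exists (Ordinal mN); rewrite /resample (bigD1 (Ordinal mN))//= big1 ?addr0.
  rewrite indicE mem_set ?scale1r//= in_itv/= wmt ltNge.
  by apply/negP => /m_max; rewrite ltnn.
move=> i; rewrite -val_eqE/= => im; rewrite indicE memNset ?scale0r//=.
rewrite in_itv/= => /andP[wit wit1].
have := m_max _ wit; rewrite leq_eqVlt (negbTE im)/= => /cumul_le.
by rewrite leNgt (le_lt_trans wmt).
Qed.

(** * Elementary inequalities *)

(** Convexity of the square at [alpha a + (1 - alpha) (b / (1 - alpha))]. *)
Lemma sqr_convex_le (R : realFieldType) (alpha a b : R) : 0 <= alpha < 1 ->
  (alpha * a + b) ^+ 2 <= alpha * a ^+ 2 + b ^+ 2 / (1 - alpha).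
Proof.
move=> /andP[alpha0 alpha1].
have ne0 : 1 - alpha != 0 by rewrite subr_eq0 gt_eqF.
rewrite -subr_ge0.
rewrite [X in 0 <= X](_ : _ = alpha / (1 - alpha) * ((1 - alpha) * a - b) ^+ 2).
  by rewrite mulr_ge0 ?sqr_ge0// divr_ge0// subr_ge0 ltW.
by field.
Qed.

Lemma sqr_sum3_le (R : realDomainType) (a b c : R) :
  (a + b + c) ^+ 2 <= 3 * (a ^+ 2 + b ^+ 2 + c ^+ 2).
Proof.
by have := sqr_ge0 (a - b); have := sqr_ge0 (b - c); have := sqr_ge0 (a - c);
  nra.
Qed.

(** * Integrals of nonnegative functions *)

(** Immediate from the definition of the integral as a supremum over simple
    functions; neither function needs to be measurable. *)
Lemma ge0_le_integral_nonmeasurable d (T : measurableType d) (R : realType)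
    (mu : {measure set T -> \bar R}) (f g : T -> \bar R) :
  (forall x, 0 <= f x)%E -> (forall x, f x <= g x)%E ->
  (\int[mu]_x f x <= \int[mu]_x g x)%E.
Proof.
move=> f0 fg; have g0 x : (0 <= g x)%E by rewrite (le_trans (f0 x)).
rewrite !ge0_integralTE//; apply: ereal_sup_le => _ [h hf <-].
by exists h => // x; rewrite (le_trans (hf x)).
Qed.

(** Only the larger function needs to be measurable: it can then be replaced by
    +oo on the exceptional null set without changing its integral. *)
Lemma ge0_ae_le_integral_nonmeasurable d (T : measurableType d) (R : realType)
    (mu : {measure set T -> \bar R}) (f g : T -> \bar R) :
  (forall x, 0 <= f x)%E -> measurable_fun setT g -> (forall x, 0 <= g x)%E ->
  {ae mu, forall x, f x <= g x}%E ->
  (\int[mu]_x f x <= \int[mu]_x g x)%E.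
Proof.
move=> f0 mg g0 [A [mA muA0 fgA]].
have mCA : measurable (~` A) by exact: measurableC.
pose g' := fun x => if x \in A then +oo%E else g x.
have mg' : measurable_fun setT g'.
  apply: measurable_fun_if => //.
  - by apply: (measurable_fun_bool true); rewrite setTI preimage_mem_true.
  - exact: measurable_funTS.
have -> : (\int[mu]_x g x = \int[mu]_x g' x)%E.
  apply: ge0_ae_eq_integral => //.
    by move=> x _; rewrite /g'; case: ifP; rewrite ?leey.
  exists A; split => // x /= xg; apply: contrapT => xA; apply: xg => _.
  by rewrite /g' memNset.
apply: ge0_le_integral_nonmeasurable => // x; rewrite /g'.
case: ifPn => [_|/negP xA]; first exact: leey.
by apply: contrapT => fgx; apply: xA; rewrite inE; exact: fgA.
Qed.

Section density.
Context d (T : measurableType d) (R : realType).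
Variables (mu m : {measure set T -> \bar R}) (p : T -> R).
Hypotheses (mp : measurable_fun setT p) (p_ge0 : forall x, 0 <= p x).
Hypothesis mE :
  forall A, measurable A -> m A = (\int[mu]_(x in A) (p x)%:E)%E.

Import HBNNSimple.

Let integral_density_nnsfun (f : {nnsfun T >-> R}) :
  (\int[m]_x (f x)%:E = \int[mu]_x ((f x)%:E * (p x)%:E))%E.
Proof.
under [LHS]eq_integral do rewrite fimfunE -fsumEFin//.
rewrite [LHS]ge0_integral_fsum//; last 2 first.
  - by move=> r; exact/measurable_EFinP/measurableT_comp.
  - by move=> n x _; rewrite EFinM nnfun_muleindic_ge0.
under [RHS]eq_integral.
  move=> x _; rewrite fimfunE -fsumEFin// muleC ge0_mule_fsumr; last first.
    by move=> r; rewrite EFinM nnfun_muleindic_ge0.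
  over.
rewrite [RHS]ge0_integral_fsum//; last 2 first.
  - move=> r; apply: emeasurable_funM; first exact/measurable_EFinP.
    exact/measurable_EFinP/measurableT_comp.
  - move=> n x _; apply: mule_ge0; first by rewrite lee_fin.
    by rewrite EFinM nnfun_muleindic_ge0.
apply: eq_fsbigr => r _; under [RHS]eq_integral do rewrite EFinM muleCA.
have mfr : measurable (f @^-1` [set r]) by [].
have [r0|r0] := leP 0 r; last first.
  rewrite preimage_nnfun0//.
  under eq_integral do rewrite indic0 mulr0.
  under [RHS]eq_integral do rewrite indic0 mule0 mule0.
  by rewrite !integral0.
rewrite integralZl_indic_nnsfun//= integral_indic// setIT ge0_integralZl//=.
- congr (_ * _)%E; rewrite mE// [LHS]integral_mkcond; apply: eq_integral => x _.
  by rewrite patchE indicE; case: ifPn => _; rewrite ?mule1 ?mule0.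
- by apply: emeasurable_funM; exact/measurable_EFinP.
- by move=> x _; rewrite mule_ge0 ?lee_fin.
Qed.

(** The integral against a measure with density [p] with respect to [mu]. *)
Lemma ge0_integral_density (f : T -> \bar R) :
  measurable_fun setT f -> (forall x, 0 <= f x)%E ->
  (\int[m]_x f x = \int[mu]_x (f x * (p x)%:E))%E.
Proof.
move=> mf f0; pose f_ := nnsfun_approx measurableT mf.
have f_cvg x : ((f_ n x)%:E @[n --> \oo] --> f x)%E by exact: cvg_nnsfun_approx.
have f_nd x : {homo (fun n => (f_ n x)%:E) : k n / (k <= n)%N >-> (k <= n)%E}.
  by move=> k n kn; rewrite lee_fin; exact/lefP/nd_nnsfun_approx.
have -> : (\int[m]_x f x = lim (\int[m]_x (f_ n x)%:E @[n --> \oo]))%E.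
  rewrite -monotone_convergence//=.
  - by apply: eq_integral => x _; exact/esym/cvg_lim.
  - by move=> n; exact/measurable_EFinP/measurable_funTS.
  - by move=> n x _; rewrite lee_fin.
under eq_fun do rewrite integral_density_nnsfun.
rewrite -monotone_convergence//=.
- apply: eq_integral => x _; apply/cvg_lim => //.
  by apply: cvgeZr.
- move=> n; apply: emeasurable_funM; last exact/measurable_EFinP.
  exact/measurable_EFinP/measurable_funTS.
- by move=> n x _; rewrite mule_ge0 ?lee_fin.
- by move=> x _ k n kn; rewrite lee_wpmul2r ?lee_fin//; exact: f_nd.
Qed.

End density.

(** Transfer formula. *)
Lemma ge0_integral_law d (Omega : measurableType d) (R : realType)
    (P : probability Omega R) d' (E : measurableType d') (X : Omega -> E)
    (mu : {measure set E -> \bar R}) (f : E -> \bar R) :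
  has_law P X mu -> measurable_fun setT f -> (forall x, 0 <= f x)%E ->
  (\int[P]_w f (X w) = \int[mu]_x f x)%E.
Proof.
move=> [mX XE] mf f0.
rewrite -(@eq_measure_integral _ _ _ _ mu (pushforward P X)) => [|A mA _].
  by rewrite (ge0_integral_pushforward mX)// preimage_setT.
exact: XE.
Qed.

(** * Second moments of Gaussian variables *)

(** With [t = x^2 / (4 s^2)], the density at [x] of standard deviation [s] is
    [expR (- t)] times, up to the factor [sqrt 2], the density of standard
    deviation [sqrt 2 s]; then [t * expR (- t) <= 1] absorbs the square. This
    bounds the second moment without integrating by parts. *)
Lemma sqr_normal_pdf_le (R : realType) (s x : R) : 0 < s ->
  x ^+ 2 * normal_pdf 0 s x <=
    4 * Num.sqrt 2 * s ^+ 2 * normal_pdf 0 (Num.sqrt 2 * s) x.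
Proof.
move=> s0; have q0 : 0 < Num.sqrt 2 :> R by rewrite sqrtr_gt0.
have qs0 : 0 < Num.sqrt 2 * s by rewrite mulr_gt0.
rewrite !normal_pdfE ?gt_eqF// /normal_fun !subr0 exprMn sqr_sqrtr//.
have -> : normal_peak (Num.sqrt 2 * s) = normal_peak s / Num.sqrt 2.
  rewrite /normal_peak exprMn sqr_sqrtr// -mulrA -mulrnAr.
  by rewrite sqrtrM// invfM mulrC.
set t := x ^+ 2 / (4 * s ^+ 2).
have sN0 : s != 0 by rewrite gt_eqF.
have -> : - x ^+ 2 / (s ^+ 2 *+ 2) = - t + - t.
  by rewrite /t -mulr_natr; field; rewrite ?sN0.
have -> : - x ^+ 2 / (2 * s ^+ 2 *+ 2) = - t.
  by rewrite /t -mulr_natr; field; rewrite ?sN0.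
have xE : x ^+ 2 = 4 * s ^+ 2 * t by rewrite /t; field; rewrite ?sN0.
rewrite expRD.
have tle : t * expR (- t) <= 1.
  rewrite expRN ler_pdivrMr ?expR_gt0// mul1r.
  by rewrite (le_trans _ (expR_ge1Dx t))// lerDr.
have -> : 4 * Num.sqrt 2 * s ^+ 2 * (normal_peak s / Num.sqrt 2 * expR (- t)) =
    (4 * s ^+ 2 * normal_peak s * expR (- t)) * 1.
  by field; rewrite gt_eqF.
rewrite xE.
rewrite [leLHS](_ : _ =
    (4 * s ^+ 2 * normal_peak s * expR (- t)) * (t * expR (- t))); last by ring.
by rewrite ler_wpM2l// !mulr_ge0 ?normal_peak_ge0 ?expR_ge0// ltW.
Qed.

Lemma normal_prob_second_moment_le (R : realType) (s : R) : 0 < s ->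
  (\int[normal_prob 0 s]_x (x ^+ 2)%:E <= (4 * Num.sqrt 2 * s ^+ 2)%:E)%E.
Proof.
move=> s0.
rewrite (@ge0_integral_density _ _ _ lebesgue_measure _ (normal_pdf 0 s))//.
- apply: (@le_trans _ _ (\int[lebesgue_measure]_x
     ((4 * Num.sqrt 2 * s ^+ 2)%:E * (normal_pdf 0 (Num.sqrt 2 * s) x)%:E))%E).
    apply: ge0_le_integral_nonmeasurable => x.
      by rewrite mule_ge0// lee_fin ?sqr_ge0 ?normal_pdf_ge0.
    by rewrite -!EFinM lee_fin sqr_normal_pdf_le.
  rewrite ge0_integralZl//=.
  + by rewrite integral_normal_pdf mule1.
  + by apply/measurable_EFinP; exact: measurable_normal_pdf.
  + by move=> x _; rewrite lee_fin normal_pdf_ge0.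
  + by rewrite lee_fin mulr_ge0 ?sqr_ge0.
- exact: measurable_normal_pdf.
- by move=> x; exact: normal_pdf_ge0.
- exact/measurable_EFinP/measurable_funX.
- by move=> x; rewrite lee_fin sqr_ge0.
Qed.

Lemma normal1_second_moment_le d (Omega : measurableType d) (R : realType)
    (P : probability Omega R) (X : Omega -> R) (v : R) : 0 <= v ->
  has_law P X (normal1 v) ->
  (\int[P]_w (X w ^+ 2)%:E <= (4 * Num.sqrt 2 * v)%:E)%E.
Proof.
move=> v0.
have msqr : measurable_fun setT (fun x : R => (x ^+ 2)%:E).
  exact/measurable_EFinP/measurable_funX.
have sqr0 (x : R) : (0 <= (x ^+ 2)%:E)%E by rewrite lee_fin sqr_ge0.
have [->|vN0] := eqVneq v 0 => [] [mX XE].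
  have X_law : has_law P X (\d_(0 : R)).
    by split => // B mB; rewrite XE// /normal1 eqxx.
  rewrite (ge0_integral_law X_law msqr)//.
  by rewrite integral_dirac//= diracT mul1e expr0n/= mulr0.
(* [normal_prob] is a measure on [measurableTypeR R], whose measurable sets are
   those of [R]. *)
have X_law : has_law P (X : Omega -> measurableTypeR R)
    (normal_prob 0 (Num.sqrt v)).
  by split => // B mB; rewrite XE// /normal1 (negbTE vN0).
rewrite (ge0_integral_law X_law msqr)// -[in leRHS](sqr_sqrtr v0).
by rewrite normal_prob_second_moment_le// sqrtr_gt0 lt_neqAle eq_sym vN0.
Qed.

Section gaussian_second_moment.
Context d (Omega : measurableType d) (R : realType) (P : probability Omega R).
Variables (n : nat) (S : 'M[R]_n) (X : Omega -> 'cV[R]_n).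
Hypothesis X_gauss : gaussian P S X.

Lemma gaussian_coord_law i : has_law P (fun w => X w i 0) (normal1 (S i i)).
Proof.
have := X_gauss.2 (delta_mx i 0); rewrite dotv_delta_mx -colE mxE.
by under eq_fun do rewrite dotv_delta_mx.
Qed.

Lemma measurable_dotv_gaussian :
  measurable_fun setT (fun w => dotv (X w) (X w)).
Proof.
under eq_fun do rewrite dotvE.
apply: measurable_sum => i.
by apply: measurable_funM; exact: (gaussian_coord_law i).1.
Qed.

Lemma gaussian_second_moment_le : possemidefmx S ->
  (\int[P]_w (dotv (X w) (X w))%:E <= (4 * Num.sqrt 2 * \tr S)%:E)%E.
Proof.
move=> S_pos; under eq_integral do rewrite dotvE -sumEFin.
rewrite ge0_integral_sum//.
- rewrite /mxtrace mulr_sumr -sumEFin lee_sum// => i _.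
  under eq_integral do rewrite -expr2.
  apply: normal1_second_moment_le (gaussian_coord_law i).
  exact: possemidefmx_diag_ge0.
- move=> i; apply/measurable_EFinP.
  by apply: measurable_funM; exact: (gaussian_coord_law i).1.
- by move=> i w _; rewrite lee_fin -expr2 sqr_ge0.
Qed.

End gaussian_second_moment.

(** * Almost sure and asymptotic statements *)

(** The uniform law lives on the closed interval; its right endpoint, which lies
    in no resampling interval, is negligible. *)
Lemma uniform_law_itvco d (Omega : measurableType d) (R : realType)
    (P : probability Omega R) (X : Omega -> R) :
  has_law P X (uniform_prob (@ltr01 R)) ->
  {ae P, forall w, 0 <= X w < 1}.
Proof.
move=> [mX XE].
have mI : measurable (`[0, 1[%classic : set R) by exact: measurable_itv.
exists (X @^-1` ~` `[0, 1[%classic); split.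
- by rewrite -[X in measurable X]setTI; apply: mX => //; exact: measurableC.
- rewrite XE; last exact: measurableC.
  rewrite /uniform_prob integral_uniform_pdf.
  rewrite (_ : _ `&` _ = [set 1]); last first.
    apply/seteqP; split=> x /=; rewrite !in_itv/=.
      move=> [/negP x01 /andP[x0 x1]]; apply/eqP; rewrite eq_le x1.
      by move: x01; rewrite x0 -leNgt.
    by move=> ->; rewrite ltxx lexx ler01 andbF.
  apply: null_set_integral;
    [exact: measurable_set1| |exact: lebesgue_measure_set1].
  by apply/measurable_funTS/measurable_EFinP; exact: measurable_uniform_pdf.
- by move=> w /=; rewrite in_itv.
Qed.

Lemma limn_esup_le_near (R : realType) (a : (\bar R)^nat) (b : R^nat) (L : R) :
  (\forall k \near \oo, a k <= (b k)%:E)%E -> b @ \oo --> L ->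
  (limn_esup a <= L%:E)%E.
Proof.
move=> ab bL; apply/lee_addgt0Pr => e e0.
apply: ge_ereal_inf; exists (ereal_sup (a @` [set k | a k <= (L + e)%:E]%E)).
  exists [set k | a k <= (L + e)%:E]%E => //.
  have bLe : \forall k \near \oo, b k <= L + e.
    move/cvgrPdist_le : bL => /(_ _ e0); apply: filterS => k.
    by rewrite ler_distlC => /andP[].
  by apply: filterS2 ab bLe => k akb bke; rewrite /= (le_trans akb)// lee_fin.
by apply: ge_ereal_sup => _ [k /= ak <-].
Qed.

(** The bound constrains [a] from index 1 on: [a 0] may be infinite. *)
Lemma limn_esup_affine_rec (R : realType) (a : (\bar R)^nat) (b : R^nat)
    (alpha q : R) : 0 <= alpha < 1 ->
  (forall k, b k.+1 = alpha * b k + q) ->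
  (forall k, a k.+1 <= (b k)%:E)%E ->
  (limn_esup a <= (q / (1 - alpha))%:E)%E.
Proof.
move=> /andP[alpha0 alpha1] bS ab; set L := q / (1 - alpha).
have bE k : b k = geometric (b 0%N - L) alpha k + L.
  elim: k => [|k IHk]; first by rewrite /= expr0 mulr1 subrK.
  rewrite bS IHk /= exprS /L; field.
  by rewrite subr_eq0 gt_eqF.
apply: (@limn_esup_le_near _ _ (fun k => b k.-1)).
  by exists 1%N => // -[//|k] _; exact: ab.
rewrite -(cvg_shiftS (fun k => b k.-1))/=.
rewrite (_ : b = fun k => geometric (b 0%N - L) alpha k + L); last exact/funext.
suff : (geometric (b 0%N - L) alpha k + L) @[k --> \oo] --> 0 + L.
  by rewrite add0r.
apply: cvgD; last exact: cvg_cst.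
by apply: cvg_geometric; rewrite ger0_norm.
Qed.

(** * Pathwise error recursion *)

Section weights.
Context (R : realType) (dX dY N : nat).
Variables (psi : 'cV[R]_dX -> 'cV[R]_dX) (H : 'M[R]_(dY, dX)).
Variables (Sigma : 'M[R]_dX) (Gamma : 'M[R]_dY).
Variables (v : 'I_N -> 'cV[R]_dX) (y : 'cV[R]_dY).

Lemma weight_ge0 n : 0 <= weight psi H Sigma Gamma v y n.
Proof.
by rewrite divr_ge0 ?expR_ge0// sumr_ge0// => m _; exact: expR_ge0.
Qed.

Lemma sum_weight : (0 < N)%N -> \sum_n weight psi H Sigma Gamma v y n = 1.
Proof.
move=> N_gt0; rewrite -mulr_suml divff// gt_eqF//.
rewrite (bigD1 (Ordinal N_gt0))//= ltr_wpDr ?expR_gt0//.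
by rewrite sumr_ge0// => m _; exact: expR_ge0.
Qed.

End weights.

(** The solution of the error recursion with noise level [V k] at step [k],
    whose value at [k] bounds the squared error at time [k.+1]. [B] bounds the
    squared norm of the differences of the contracted dynamics; it replaces the
    initial error. *)
Fixpoint error_majorant (R : realType) (alpha B : R) (V : nat -> R) (k : nat) :
    R :=
  if k is k'.+1 then alpha * error_majorant alpha B V k' + V k / (1 - alpha)
  else 2 * (B + V 0).

Section pathwise.
Context (R : realType) (dX dY N : nat).
Variables (psi : 'cV[R]_dX -> 'cV[R]_dX) (H : 'M[R]_(dY, dX)).
Variables (Sigma : 'M[R]_dX) (Gamma : 'M[R]_dY) (nrm : 'cV[R]_dX -> R).
Variables (s gamma alpha B : R) (u0 : 'cV[R]_dX).
Variables (xi : nat -> 'cV[R]_dX) (eta : nat -> 'cV[R]_dY).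
Variables (v0 : 'I_N -> 'cV[R]_dX) (rho : nat -> 'I_N -> R).
Variables (zeta : nat -> 'I_N -> 'cV[R]_dX) (V : nat -> R).

Let K := gain H Sigma Gamma.
Let A := 1%:M - K *m H.
Let u := truth psi s u0 xi.
Let y := observations H gamma u eta.
Let v := gopf psi H Sigma Gamma y v0 rho zeta.
Let vt k n :=
  resample (weight psi H Sigma Gamma (v k) (y k.+1)) (v k) (rho k.+1 n).
Let M k := \big[Num.max/0]_(n < N) nrm (v k n - u k) ^+ 2.

(** The part of the error at time [k.+1] of the particle [n] that is created by
    the noises of that step. *)
Definition gopf_error_noise k n : 'cV[R]_dX :=
  A *m (- s *: xi k) + K *m (gamma *: eta k.+1) + zeta k n.

Lemma gopf_sub_truth k n :
  v k.+1 n - u k.+1 =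
  (A *m psi (vt k n) - A *m psi (u k)) + gopf_error_noise k n.
Proof.
have -> : v k.+1 n =
    A *m psi (vt k n) + K *m (H *m u k.+1 + gamma *: eta k.+1) + zeta k n by [].
have -> : u k.+1 = psi (u k) + s *: xi k by [].
have AE (x : 'cV_dX) : A *m x = x - K *m (H *m x).
  by rewrite mulmxBl mul1mx mulmxA.
rewrite /gopf_error_noise !(AE (psi (u k))) !(AE (- s *: _)) scaleNr !mulmxN.
rewrite !mulmxDr.
by apply/matrixP => i j; rewrite !mxE; ring.
Qed.

Hypothesis N_gt0 : (0 < N)%N.
Hypothesis nrm_norm : is_norm nrm.
Hypothesis alpha01 : 0 <= alpha < 1.
Hypothesis contraction : forall x z : 'cV[R]_dX,
  nrm (A *m psi x - A *m psi z) <= alpha * nrm (x - z).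
Hypothesis bounded : forall x z : 'cV[R]_dX,
  nrm (A *m psi x - A *m psi z) ^+ 2 <= B.
Hypothesis noise_le : forall k n, nrm (gopf_error_noise k n) ^+ 2 <= V k.
Hypothesis rho01 : forall k n, 0 <= rho k.+1 n < 1.

Let nrm_ge0 x : 0 <= nrm x.
Proof. by case: nrm_norm => nD nZ _; exact: seminorm_ge0. Qed.

Let nrmD x z : nrm (x + z) <= nrm x + nrm z.
Proof. by case: nrm_norm. Qed.

Lemma gopf_error_step k n :
  nrm (v k.+1 n - u k.+1) ^+ 2 <= alpha * M k + V k / (1 - alpha).
Proof.
case/andP: (alpha01) => alpha0 alpha1.
have [m vtE] : exists m, vt k n = v k m.
  by apply: resample_mem => // [m|]; [exact: weight_ge0|exact: sum_weight].
have e_le : nrm (v k.+1 n - u k.+1) <=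
    alpha * nrm (v k m - u k) + nrm (gopf_error_noise k n).
  by rewrite gopf_sub_truth vtE (le_trans (nrmD _ _))// lerD2r contraction.
apply: (@le_trans _ _ ((alpha * nrm (v k m - u k)
    + nrm (gopf_error_noise k n)) ^+ 2)).
  by rewrite ler_sqr ?nnegrE ?addr_ge0 ?mulr_ge0.
rewrite (le_trans (sqr_convex_le _ _ alpha01))// lerD//.
  by rewrite ler_wpM2l// /M (le_bigmax _ (fun n => nrm (v k n - u k) ^+ 2)).
by rewrite ler_wpM2r// invr_ge0 subr_ge0 ltW.
Qed.

(** The first error is bounded independently of the initial particles. *)
Lemma gopf_error_first n : nrm (v 1%N n - u 1%N) ^+ 2 <= 2 * (B + V 0%N).
Proof.
rewrite gopf_sub_truth; set a := _ - _; set b := gopf_error_noise _ _.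
apply: (@le_trans _ _ ((nrm a + nrm b) ^+ 2)).
  by rewrite ler_sqr ?nnegrE ?addr_ge0.
have aB : nrm a ^+ 2 <= B := bounded _ _.
have bV : nrm b ^+ 2 <= V 0%N := noise_le _ _.
by have := sqr_ge0 (nrm a - nrm b); nra.
Qed.

Lemma gopf_error_le_majorant k :
  M k.+1 <= error_majorant alpha B V k.
Proof.
case/andP: (alpha01) => alpha0 alpha1.
have V_ge0 j : 0 <= V j.
  by rewrite (le_trans _ (noise_le j (Ordinal N_gt0)))// sqr_ge0.
have B_ge0 : 0 <= B by rewrite (le_trans _ (bounded 0 0))// sqr_ge0.
have maj_ge0 j : 0 <= error_majorant alpha B V j.
  elim: j => [|j IHj] /=; first by rewrite mulr_ge0// addr_ge0.
  by rewrite addr_ge0 ?mulr_ge0// invr_ge0 subr_ge0 ltW.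
elim: k => [|k IHk].
  by apply: bigmax_le => // n _; exact: gopf_error_first.
apply: bigmax_le => // n _; rewrite (le_trans (gopf_error_step _ _))//=.
by rewrite lerD2r ler_wpM2l.
Qed.

End pathwise.

(** * Expectation of the majorant *)

Lemma ge0_integral_lincomb_le d (T : measurableType d) (R : realType)
    (mu : {measure set T -> \bar R}) (a b F G : R) (f g : T -> R) :
  0 <= a -> 0 <= b ->
  measurable_fun setT f -> measurable_fun setT g ->
  (forall x, 0 <= f x) -> (forall x, 0 <= g x) ->
  (\int[mu]_x (f x)%:E <= F%:E)%E -> (\int[mu]_x (g x)%:E <= G%:E)%E ->
  (\int[mu]_x (a * f x + b * g x)%:E <= (a * F + b * G)%:E)%E.
Proof.
move=> a0 b0 mf mg f0 g0 fF gG.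
have mEf : measurable_fun setT (fun x => (f x)%:E) by exact/measurable_EFinP.
have mEg : measurable_fun setT (fun x => (g x)%:E) by exact/measurable_EFinP.
under eq_integral do rewrite EFinD !EFinM.
rewrite ge0_integralD//.
- rewrite !ge0_integralZl//.
  + by rewrite EFinD !EFinM leeD// lee_wpmul2l.
  + by move=> x _; rewrite lee_fin.
  + by move=> x _; rewrite lee_fin.
- by move=> x _; rewrite mule_ge0// lee_fin.
- by apply: emeasurable_funM.
- by move=> x _; rewrite mule_ge0// lee_fin.
- by apply: emeasurable_funM.
Qed.

Section integral_majorant.
Context d (Omega : measurableType d) (R : realType) (P : probability Omega R).
Variables (alpha B D : R) (V : nat -> Omega -> R).
Hypotheses (alpha01 : 0 <= alpha < 1) (B_ge0 : 0 <= B).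
Hypotheses (mV : forall k, measurable_fun setT (V k)).
Hypotheses (V_ge0 : forall k w, 0 <= V k w).
Hypothesis V_le : forall k, (\int[P]_w (V k w)%:E <= D%:E)%E.

Let G k w := error_majorant alpha B (V^~ w) k.

Lemma error_majorant_ge0 k w : 0 <= G k w.
Proof.
case/andP: alpha01 => alpha0 alpha1; rewrite /G.
elim: k => [|k IHk] /=; first by rewrite mulr_ge0// addr_ge0.
by rewrite addr_ge0 ?mulr_ge0// invr_ge0 subr_ge0 ltW.
Qed.

Lemma measurable_error_majorant k : measurable_fun setT (G k).
Proof.
rewrite /G; elim: k => [|k IHk] /=.
  by apply: measurable_funM => //; exact: measurable_funD.
by apply: measurable_funD; exact: measurable_funM.
Qed.

(** The majorant is affine in the noise levels with nonnegative coefficients, so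
    its expectation is bounded by its value at the bounds of their means. *)
Lemma integral_error_majorant_le k :
  (\int[P]_w (G k w)%:E <= (error_majorant alpha B (cst D) k)%:E)%E.
Proof.
case/andP: alpha01 => alpha0 alpha1; rewrite /G.
elim: k => [|k IHk] /=.
  rewrite mulrDr; under eq_integral do rewrite mulrDr.
  apply: ge0_integral_lincomb_le => //.
  by rewrite integral_cst// [X in (_ * X)%E]probability_setT mule1.
rewrite [D / _]mulrC; under eq_integral do rewrite [V _ _ / _]mulrC.
apply: ge0_integral_lincomb_le => //.
- by rewrite invr_ge0 subr_ge0 ltW.
- exact: measurable_error_majorant.
- by move=> w; exact: error_majorant_ge0.
Qed.

End integral_majorant.

(** * Constants of the model *)

Lemma contraction_image_bounded (R : realType) m n (p : 'cV[R]_m -> R)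
    (A : 'M[R]_(m, n)) (psi : 'cV[R]_n -> 'cV[R]_n) : is_norm p ->
  (exists M : R, forall x, enorm (psi x) <= M) ->
  exists2 B : R, 0 <= B &
    forall x z, p (A *m psi x - A *m psi z) ^+ 2 <= B.
Proof.
move=> p_norm [M psi_le].
have [kappa kappa0 kappa_le] := seminorm_mulmx_sqr_le_dotv A p_norm.
case: p_norm => pD pZ _; have p0 := seminorm_ge0 pD pZ.
have pA_le x : p (A *m psi x) ^+ 2 <= kappa * M ^+ 2.
  rewrite (le_trans (kappa_le _))// ler_wpM2l//.
  rewrite -[leLHS]sqr_sqrtr ?dotv_ge0// ler_sqr ?nnegrE ?sqrtr_ge0//.
  exact: psi_le.
  by rewrite (le_trans (sqrtr_ge0 _) (psi_le x)).
exists (4 * (kappa * M ^+ 2)); first by rewrite mulr_ge0// mulr_ge0// sqr_ge0.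
move=> x z; apply: (@le_trans _ _ ((p (A *m psi x) + p (A *m psi z)) ^+ 2)).
  by rewrite ler_sqr ?nnegrE ?addr_ge0// (le_trans (pD _ _))// seminormN.
have := pA_le x; have := pA_le z.
by have := sqr_ge0 (p (A *m psi x) - p (A *m psi z)); nra.
Qed.

Lemma gaussian_quadratic_le d (Omega : measurableType d) (R : realType)
    (P : probability Omega R) m n N (a b c : R) (S : 'M[R]_m) (T : 'M[R]_n)
    (C : 'M[R]_m) (X : Omega -> 'cV[R]_m) (Y : Omega -> 'cV[R]_n)
    (Z : 'I_N -> Omega -> 'cV[R]_m) :
  0 <= a -> 0 <= b -> 0 <= c ->
  possemidefmx S -> possemidefmx T -> possemidefmx C ->
  gaussian P S X -> gaussian P T Y -> (forall i, gaussian P C (Z i)) ->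
  (\int[P]_w (a * dotv (X w) (X w) + b * dotv (Y w) (Y w)
     + c * \sum_i dotv (Z i w) (Z i w))%:E <=
   (4 * Num.sqrt 2 * (a * \tr S + b * \tr T + c * (\tr C *+ N)))%:E)%E.
Proof.
move=> a0 b0 c0 S_pos T_pos C_pos X_gauss Y_gauss Z_gauss.
have mX := measurable_dotv_gaussian X_gauss.
have mY := measurable_dotv_gaussian Y_gauss.
have mZ i := measurable_dotv_gaussian (Z_gauss i).
have Z_le : (\int[P]_w (\sum_i dotv (Z i w) (Z i w))%:E <=
    (4 * Num.sqrt 2 * (\tr C *+ N))%:E)%E.
  under eq_integral do rewrite -sumEFin.
  rewrite ge0_integral_sum//.
  - rewrite mulrnAr -[X in (_ *+ X)%:E](card_ord N) -sumr_const -sumEFin.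
    apply: lee_sum => i _.
    exact: gaussian_second_moment_le (Z_gauss i) C_pos.
  - by move=> i; exact/measurable_EFinP.
  - by move=> i w _; rewrite lee_fin dotv_ge0.
have -> : 4 * Num.sqrt 2 * (a * \tr S + b * \tr T + c * (\tr C *+ N)) =
    1 * (a * (4 * Num.sqrt 2 * \tr S) + b * (4 * Num.sqrt 2 * \tr T))
    + c * (4 * Num.sqrt 2 * (\tr C *+ N)) by ring.
under eq_integral do rewrite -[X in X + c * _]mul1r.
apply: ge0_integral_lincomb_le => //.
- by apply: measurable_funD; exact: measurable_funM.
- exact: measurable_sum.
- by move=> w; rewrite addr_ge0 ?mulr_ge0 ?dotv_ge0.
- by move=> w; rewrite sumr_ge0// => i _; exact: dotv_ge0.
apply: ge0_integral_lincomb_le => //.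
- by move=> w; exact: dotv_ge0.
- by move=> w; exact: dotv_ge0.
- exact: gaussian_second_moment_le X_gauss S_pos.
- exact: gaussian_second_moment_le Y_gauss T_pos.
Qed.

(** * Accuracy of the filter *)

Theorem theorem5p2 (R : realType) (dX dY : nat)
    (psi : 'cV[R]_dX -> 'cV[R]_dX) (H : 'M[R]_(dY, dX))
    (Sigma0 : 'M[R]_dX) (Gamma0 : 'M[R]_dY)
    (mu0 : probability (borelcV R dX) R)
    (nrm : 'cV[R]_dX -> R) (r_c : R)
    (u0 : 'cV[R]_dX) (Sigmas : 'M[R]_dX) (Gammas : 'M[R]_dY)
    (N : nat) (r : R)
    (d : measure_display) (Omega : measurableType d) (P : probability Omega R)
    (xi : nat -> Omega -> 'cV[R]_dX) (eta : nat -> Omega -> 'cV[R]_dY)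
    (psi_meas : measurable_fun setT (psi : borelcV R dX -> borelcV R dX))
    (psi_bounded : exists M : R, forall x, enorm (psi x) <= M)
    (Sigma0_pos : posdefmx Sigma0) (Gamma0_pos : posdefmx Gamma0)
    (nrm_norm : is_norm nrm) (r_c_gt0 : 0 < r_c)
    (psi_contraction : contraction_assumption psi H Sigma0 Gamma0 nrm r_c)
    (Sigmas_pos : possemidefmx Sigmas) (Gammas_pos : possemidefmx Gammas)
    (N_ge1 : (1 <= N)%N) (r_itv : 0 <= r < r_c)
    (xi_eta_noise : data_noise P Sigmas Gammas xi eta) :
  exists c : R, forall sigma gamma : R,
    0 < sigma -> 0 < gamma -> r = sigma / gamma ->
    let Sigma : 'M[R]_dX := sigma ^+ 2 *: Sigma0 in
    let Gamma : 'M[R]_dY := gamma ^+ 2 *: Gamma0 in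
    forall (v0 : 'I_N -> Omega -> 'cV[R]_dX) (rho : nat -> 'I_N -> Omega -> R)
      (zeta : nat -> 'I_N -> Omega -> 'cV[R]_dX),
    filter_noise P mu0 (post_cov H Sigma Gamma) xi eta v0 rho zeta ->
    let u k (w : Omega) := truth psi (r * gamma) u0 (fun j => xi j w) k in
    let y k (w : Omega) :=
      observations H gamma (fun j => u j w) (fun j => eta j w) k in
    let v k (n : 'I_N) (w : Omega) :=
      gopf psi H Sigma Gamma (fun j => y j w) (fun m => v0 m w)
        (fun j m => rho j m w) (fun j m => zeta j m w) k n in
    (limn_esup (fun k =>
       'E_P[fun w => \big[Num.max/0%R]_(n < N) (nrm (v k n w - u k w) ^+ 2)%R])
     <= (c * gamma ^+ 2)%:E)%E.
Proof.
have [alpha alpha01 contr] := psi_contraction _ r_itv.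
pose K := gain H (r ^+ 2 *: Sigma0) Gamma0.
pose A := 1%:M - K *m H.
have [B B_ge0 B_le] := contraction_image_bounded A nrm_norm psi_bounded.
have [ka ka0 ka_le] := seminorm_mulmx_sqr_le_dotv A nrm_norm.
have [kk kk0 kk_le] := seminorm_mulmx_sqr_le_dotv K nrm_norm.
have [kn kn0 kn_le] := seminorm_mulmx_sqr_le_dotv 1%:M nrm_norm.
pose C0 := post_cov H (r ^+ 2 *: Sigma0) Gamma0.
(* [gamma ^+ 2 * D] bounds the mean of the squared noise of one step: the factor
   3 comes from the square of a sum of three terms. *)
pose D := 4 * Num.sqrt 2 * (3 * r ^+ 2 * ka * \tr Sigmas + 3 * kk * \tr Gammas
  + 3 * kn * (\tr C0 *+ N)).
exists (D / (1 - alpha) / (1 - alpha)).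
move=> sigma gamma sigma0 gamma0 rE Sigma Gamma.
have r0 : 0 < r by rewrite rE divr_gt0.
have g2 : 0 < gamma ^+ 2 by rewrite exprn_gt0.
have rS_pos : posdefmx (r ^+ 2 *: Sigma0).
  by apply: posdefmxZ => //; rewrite exprn_gt0.
have SigmaE : Sigma = gamma ^+ 2 *: (r ^+ 2 *: Sigma0).
  by rewrite scalerA -exprMn rE mulrC divfK ?gt_eqF.
have KE : gain H Sigma Gamma = K by rewrite SigmaE gainZ.
have CE : post_cov H Sigma Gamma = gamma ^+ 2 *: C0 by rewrite SigmaE post_covZ.
move=> v0 rho zeta [_ rho_unif zeta_gauss _]; cbv zeta.
case: xi_eta_noise => xi_gauss eta_gauss _.
(* The sum over [n] makes [V k w] a bound for the noises of all particles. *)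
pose V k w : R := 3 * (r * gamma) ^+ 2 * ka * dotv (xi k w) (xi k w)
  + 3 * gamma ^+ 2 * kk * dotv (eta k.+1 w) (eta k.+1 w)
  + 3 * kn * \sum_n dotv (zeta k n w) (zeta k n w).
have c1 : 0 <= 3 * (r * gamma) ^+ 2 * ka.
  by rewrite mulr_ge0// mulr_ge0// sqr_ge0.
have c2 : 0 <= 3 * gamma ^+ 2 * kk by rewrite mulr_ge0// mulr_ge0// sqr_ge0.
have c3 : 0 <= 3 * kn by rewrite mulr_ge0.
have V_ge0 k w : 0 <= V k w.
  apply: addr_ge0; [apply: addr_ge0|]; apply: mulr_ge0; rewrite ?dotv_ge0//.
  by rewrite sumr_ge0// => n _; exact: dotv_ge0.
have mV k : measurable_fun setT (V k).
  apply: measurable_funD; [apply: measurable_funD|];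
    apply: measurable_funM => //.
  - exact: measurable_dotv_gaussian (xi_gauss k).
  - exact: measurable_dotv_gaussian (eta_gauss k).
  - apply: measurable_sum => n.
    exact: measurable_dotv_gaussian (zeta_gauss k n).
have V_le k : (\int[P]_w (V k w)%:E <= (D * gamma ^+ 2)%:E)%E.
  have C_pos : possemidefmx (post_cov H Sigma Gamma).
    apply: posdefmx_possemidefmx; rewrite CE.
    by apply: posdefmxZ => //; exact: posdefmx_post_cov.
  have := gaussian_quadratic_le c1 c2 c3 Sigmas_pos Gammas_pos C_pos
    (xi_gauss k) (eta_gauss k) (zeta_gauss k).
  rewrite CE mxtraceZ.
  rewrite [X in (_ <= X%:E)%E -> _](_ : _ = D * gamma ^+ 2)//.
  by rewrite /D -mulrnAr; ring.
have noise_le w k n : nrm (gopf_error_noise H Sigma Gamma (r * gamma) gamma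
    (xi^~ w) (eta^~ w) (fun j m => zeta j m w) k n) ^+ 2 <= V k w.
  rewrite /gopf_error_noise KE -/A.
  case: (nrm_norm) => nD nZ _; have n0 := seminorm_ge0 nD nZ.
  rewrite -!scalemxAr -[X in _ + X]mul1mx.
  set a := A *m _; set b := K *m _; set c := 1%:M *m _.
  apply: (@le_trans _ _ ((r * gamma * nrm a + gamma * nrm b + nrm c) ^+ 2)).
    rewrite ler_sqr ?nnegrE ?addr_ge0 ?mulr_ge0 ?(ltW r0) ?(ltW gamma0)//.
    rewrite (le_trans (nD _ _))// lerD2r (le_trans (nD _ _))// !nZ normrN.
    by rewrite normrM !gtr0_norm.
  rewrite (le_trans (sqr_sum3_le _ _ _))//.
  rewrite [leRHS](_ : _ = 3 * ((r * gamma) ^+ 2 * (ka * dotv (xi k w) (xi k w))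
      + gamma ^+ 2 * (kk * dotv (eta k.+1 w) (eta k.+1 w))
      + kn * \sum_m dotv (zeta k m w) (zeta k m w))); last by rewrite /V; ring.
  rewrite ler_wpM2l// [(_ * nrm a) ^+ 2]exprMn [(_ * nrm b) ^+ 2]exprMn.
  rewrite lerD//.
    by apply: lerD; rewrite ler_wpM2l ?sqr_ge0 ?ka_le ?kk_le.
  rewrite (le_trans (kn_le _))// ler_wpM2l// (bigD1 n)//= lerDl.
  by rewrite sumr_ge0// => m _; exact: dotv_ge0.
have rho01 : {ae P, forall w, forall k n, 0 <= rho k.+1 n w < 1}.
  apply: ae_foralln => k; apply: filter_forall => n.
  exact: uniform_law_itvco (rho_unif k n).
(* The deterministic recursion satisfied by the bounds of the means. *)
pose b := error_majorant alpha B (cst (D * gamma ^+ 2)).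
rewrite [X in (_ <= X%:E)%E](_ : _ =
  D * gamma ^+ 2 / (1 - alpha) / (1 - alpha)); last by ring.
apply: (@limn_esup_affine_rec _ _ b) => // k.
rewrite unlock.
apply: (le_trans _ (integral_error_majorant_le alpha01 B_ge0 mV V_ge0 V_le k)).
apply: ge0_ae_le_integral_nonmeasurable.
- by move=> w; rewrite lee_fin bigmax_ge_id.
- by apply/measurable_EFinP; exact: measurable_error_majorant.
- by move=> w; rewrite lee_fin error_majorant_ge0.
apply: filterS rho01 => w rho01; rewrite lee_fin.
apply: gopf_error_le_majorant => //.
- by move=> x z; rewrite KE; exact: contr.
- by move=> x z; rewrite KE; exact: B_le.
Qed.
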